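(* (i) For all integers $n,m\geq 2$, $t(nm)\geq n\,t(m)+t(n)$. (ii) For all primes $p,q\geq 3$, $t(pq)\geq pq-5$, and moreover $t(pq)\geq pq-3$ if $q-1$ divides $p-1$.
   Context: For a positive integer $n$ let $S(\mathbb{Z}_n)$ be the set of bijections $\mathbb{Z}_n\to\mathbb{Z}_n$. For $\pi\in S(\mathbb{Z}_n)$, $\mathrm{cyc}(\pi)$ is the number of cycles (including fixed points) of $\pi$ and $t(\pi)=n-\mathrm{cyc}(\pi)$. Let $[\pi]=\{x\mapsto \pi(x+b): b\in\mathbb{Z}_n\}$, $t([\pi])=\min_{\sigma\in[\pi]}t(\sigma)$, and $t(n)=\max_{\pi\in S(\mathbb{Z}_n)}t([\pi])$. *)

(* Defs.v *)
From mathcomp Require Import all_boot all_fingroup.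
Set Implicit Arguments. Unset Strict Implicit. Unset Printing Implicit Defensive.

(* Z_n is represented by 'I_n with addition modulo n. *)
Lemma ord_pos n (x : 'I_n) : 0 < n.
Proof. exact: leq_ltn_trans (leq0n x) (ltn_ord x). Qed.

Definition addmod n (b x : 'I_n) : 'I_n := Ordinal (ltn_pmod (x + b) (ord_pos x)).

Lemma addmod_inj n (b : 'I_n) : injective (addmod b).
Proof.
move=> x y /(congr1 val) /= /eqP; rewrite eqn_modDr !modn_small //.
by move/eqP/val_inj.
Qed.

Definition rotp n (b : 'I_n) : {perm 'I_n} := perm (@addmod_inj n b).

(* cyc(pi): number of cycles (fixed points included) *)
Definition cyc n (s : {perm 'I_n}) : nat := #|porbits s|.

Definition tperm n (s : {perm 'I_n}) : nat := n - cyc s.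

(* t([pi]) = min over b of t(x |-> pi(x+b)); note (rotp b * pi) x = pi (x + b) *)
Definition tclass n (pi : {perm 'I_n}) : nat :=
  \big[minn/n]_(b : 'I_n) tperm (rotp b * pi)%g.

Definition tn (n : nat) : nat := \max_(pi : {perm 'I_n}) tclass pi.

(* Main.v *)
Require Import Defs.
From mathcomp Require Import all_boot all_fingroup all_algebra all_solvable all_field.
From mathcomp Require Import zify ring.

(** All lower bounds come from skew products.  Writing [x = j + m * i] identifies
    Z_(nm) with Z_m x Z_n so that every translation becomes
    [(j, i) |-> (j + b, i + c j)].  For [F (j, i) = (rho j, phi_j i)], the cycles of
    a translate of [F] lying over a cycle C of [rho (_ + b)] are the cycles of the
    return map to a single fibre over C, a composite of translates of the [phi_j].

    (i) Take [rho] and [pi] optimal on Z_m and Z_n, [phi_0 = pi] and [phi_j = id]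
    otherwise.  One return map is conjugate to a translate of [pi]; every other cycle
    of [rho (_ + b)] carries at most n cycles.

    (ii) Take [rho j = a * j] with [a] a primitive root mod p: each translate has one
    fixed point and one cycle of length p - 1.  With [phi_j i = g ^ e_j * i], [g] a
    primitive root mod q and E the sum of the [e_j], the return maps are affine with
    multipliers [g ^ e_z] and [g ^ (E - e_z)].  Exponents for which one of [e_z],
    [E - e_z] is prime to q - 1 and the other has gcd 2 with it give at most
    2 + 3 cycles.
    If q - 1 divides p - 1 and p <> q, use Chinese remainder coordinates and
    [phi_j i = g * i + s_j]: the long return map is a translation, and a character sum
    shows that it is nonzero when [s] is built from the character [a |-> g].
    If p = q, multiplication by a generator of the units of Z_(p^2) has three cycles. *)

Set Implicit Arguments.
Unset Strict Implicit.
Unset Printing Implicit Defensive.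

Import GRing.Theory.

(** * Counting cycles by sets that meet every orbit *)

Definition hits (T : eqType) (f : T -> T) (R : seq T) :=
  forall t, exists k, iter k f t \in R.

Lemma cyc_le_hits n (s : {perm 'I_n}) (R : seq 'I_n) : hits s R -> cyc s <= size R.
Proof.
move=> sR; rewrite -(size_map (porbit s)) /cyc.
apply: leq_trans (card_size _); apply/subset_leq_card/subsetP => C /imsetP[x _ ->].
have [k Rk] := sR x; apply/mapP; exists (iter k s x) => //.
by apply/eqP; rewrite eq_porbit_mem -permX porbit_sym mem_porbit.
Qed.

(** Cycle representatives with [x0] standing for its own cycle, so that this cycle can be treated
    apart from the others. *)
Lemma hits_through n (s : {perm 'I_n}) (x0 : 'I_n) :
  exists2 R, size R = (cyc s).-1 & hits s (x0 :: R).
Proof.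
pose rep (C : {set 'I_n}) := odflt x0 [pick x in C].
exists [seq rep C | C <- enum (porbits s :\ porbit s x0)].
  by rewrite size_map -cardE /cyc (cardsD1 (porbit s x0) (porbits s)) imset_f.
move=> t; have [tx|tx] := boolP (x0 \in porbit s t).
  by have /porbitP[k ->] := tx; exists k; rewrite permX inE eqxx.
have : rep (porbit s t) \in porbit s t.
  by rewrite /rep; case: pickP => //= /(_ t); rewrite porbit_id.
case/porbitP=> k ek; exists k; rewrite -permX -ek inE; apply/orP; right.
apply/map_f; rewrite mem_enum !inE imset_f // andbT.
by apply: contra tx => /eqP->; rewrite porbit_id.
Qed.

Lemma tclass_le n (s : {perm 'I_n}) b : tclass s <= n - cyc (rotp b * s)%g.
Proof.
rewrite /tclass; have: b \in index_enum 'I_n by rewrite mem_index_enum.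
elim: (index_enum _) => //= c r IH; rewrite inE big_cons => /orP[/eqP<-|/IH].
  exact: geq_minl.
by apply: leq_trans; exact: geq_minr.
Qed.

Lemma cyc_le n (s : {perm 'I_n}) : cyc s <= n.
Proof. by apply: leq_trans (leq_imset_card _ _) _; rewrite card_ord. Qed.

Lemma tn_attained n :
  exists s : {perm 'I_n}, forall b, cyc (rotp b * s)%g <= n - tn n.
Proof.
have [|s es] := @eq_bigmax {perm 'I_n} (@tclass n); first by apply/card_gt0P; exists 1%g.
exists s => b; rewrite /tn es; move: (tclass_le s b) (cyc_le (rotp b * s)%g); lia.
Qed.

(** Conjugation by [e] turns each translate of the permutation into [F \o sh], so orbits can be
    studied in any coordinates on Z_N. *)
Lemma tn_ge (N c : nat) (T : finType) (e : 'I_N -> T) (F : T -> T) :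
  injective e -> #|T| = N -> injective F ->
  (forall b : 'I_N, exists2 sh, forall x, e (addmod b x) = sh (e x) &
     exists2 R, size R <= c & hits (F \o sh) R) ->
  N - c <= tn N.
Proof.
move=> e_inj cT F_inj H.
have [|e' eK e'K] := inj_card_bij e_inj; first by rewrite cT card_ord.
have s_inj : injective (fun x => e' (F (e x))).
  by move=> x y /(can_inj e'K)/F_inj/e_inj.
pose s := perm s_inj.
apply: leq_trans (leq_bigmax s); rewrite /tclass.
(* The default value [N] of the minimum also satisfies the bound. *)
apply: (big_ind (fun x => N - c <= x)) => [|x y|b _]; first exact: leq_subr.
  by rewrite leq_min => -> ->.
rewrite /Defs.tperm leq_sub2l //.
have [sh shE [R Rc HR]] := H b.
apply: leq_trans Rc; rewrite -(size_map e'); apply: cyc_le_hits => x.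
have [k Hk] := HR (e x); exists k.
suff -> : iter k (rotp b * s)%g x = e' (iter k (F \o sh) (e x)) by exact: map_f.
by elim: k {Hk} => [|k IH]; rewrite /= ?eK // IH permM !permE /= shE e'K.
Qed.

(** * Positional coordinates on Z_(nm) *)

Local Open Scope ring_scope.

(* [v] reads off the representative in [0, m); this covers both 'Z_m and 'F_m. *)
Definition residues (J : nzRingType) (m : nat) (v : J -> nat) :=
  (0 < m)%N /\ cancel v (fun a => a%:R) /\ forall a : nat, v a%:R = (a %% m)%N.

Lemma residues_eq (J : nzRingType) m (v : J -> nat) : residues m v ->
  forall a b : nat, (a%:R = b%:R :> J) <-> (a = b %[mod m])%N.
Proof.
case=> m0 [vK vE] a b; split; first by move/(congr1 v); rewrite !vE.
by move=> ab; rewrite -[LHS]vK -[RHS]vK !vE ab.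
Qed.

Lemma residues_Zp m : (1 < m)%N -> residues m (val : 'Z_m -> nat).
Proof.
move=> m1; split; first by lia.
by split=> [x|a]; [exact: natr_Zp | exact: val_Zp_nat].
Qed.

Lemma residues_Fp p : prime p -> residues p (val : 'F_p -> nat).
Proof.
move=> pp; split; first exact: prime_gt0.
by split=> [x|a]; [exact: natr_Zp | exact: val_Fp_nat].
Qed.

Section Digits.

Variables (J I : nzRingType) (m n : nat) (vJ : J -> nat) (vI : I -> nat).
Hypotheses (Jm : residues m vJ) (In : residues n vI).

Definition digits (x : 'I_(n * m)) : J * I := (x%:R, (x %/ m)%:R).

Lemma digits_inj : injective digits.
Proof.
have [m0 _] := Jm; move=> x y [/(residues_eq Jm) exy /(residues_eq In)].
rewrite !modn_small ?ltn_divLR // => dxy; apply: val_inj.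
by rewrite /= (divn_eq x m) (divn_eq y m) dxy exy.
Qed.

(** The carry out of the low digit depends on that digit alone. *)
Lemma digits_shift b :
  exists c : J -> I, forall x,
    digits (addmod b x) = ((digits x).1 + b%:R, (digits x).2 + c (digits x).1).
Proof.
have [m0 [_ vE]] := Jm.
exists (fun j => ((b %/ m) + (m <= vJ j + b %% m))%:R) => x.
rewrite /digits /= vE -natrD -natrD; congr pair.
  by apply/(residues_eq Jm); rewrite modn_dvdm // dvdn_mull.
by apply/(residues_eq In); rewrite -modn_divl modn_mod divnD // addnA.
Qed.

End Digits.

(** * Return maps to a fibre *)

Lemma iter_skew (J I : Type) (u : J -> J) (phi : J -> I -> I) k j i :
  (iter k (fun t : J * I => (u t.1, phi t.1 t.2)) (j, i)).1 = iter k u j.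
Proof. by elim: k => //= k ->. Qed.

Lemma hits_fibre (J I : eqType) (f : J * I -> J * I) (j : J) l (ret : I -> I) R :
  (forall i, iter l f (j, i) = (j, ret i)) -> hits ret R ->
  forall i, exists k, iter k f (j, i) \in [seq (j, i') | i' <- R].
Proof.
move=> fl retR i; have [k Hk] := retR i; exists (k * l)%N.
suff -> : iter (k * l) f (j, i) = (j, iter k ret i) by exact: map_f.
by elim: k {Hk} => //= k IH; rewrite mulSn iterD IH fl.
Qed.

(** Translation by [c] conjugates [f (_ + c)] to [f _ + c]. *)
Lemma hits_conj (I : zmodType) (f : I -> I) (c : I) R :
  hits (fun i => f (i + c)) R -> hits (fun i => f i + c) [seq i + c | i <- R].
Proof.
move=> fR i; have [k Hk] := fR (i - c); exists k.
have -> : iter k (fun i => f i + c) i = iter k (fun i => f (i + c)) (i - c) + c.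
  by elim: k {Hk} => /= [|k ->]; rewrite ?subrK.
exact: map_f.
Qed.

(** * The inequality for t(nm) *)

Lemma addmodE n (b x : 'I_n.+2) : addmod b x = x + b.
Proof. exact: val_inj. Qed.

Lemma cyc_gt0 n (s : {perm 'I_n.+1}) : (0 < cyc s)%N.
Proof. by apply/card_gt0P; exists (porbit s ord0); exact: imset_f. Qed.

Lemma tn_mul n m : (1 < n)%N -> (1 < m)%N -> (n * tn m + tn n <= tn (n * m))%N.
Proof.
case: n m => [|[|n]] // [|[|m]] // _ _.
set N := n.+2; set M := m.+2.
have [rho rhoP] := tn_attained M; have [pi piP] := tn_attained N.
have JM : residues M (val : 'I_M -> nat) := @residues_Zp M isT.
have IN : residues N (val : 'I_N -> nat) := @residues_Zp N isT.
pose F (t : 'I_M * 'I_N) := (rho t.1, if t.1 == 0 then pi t.2 else t.2).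
have F_inj : injective F.
  move=> [j i] [j' i'] [/perm_inj <-]; case: eqP => _; last by move=> ->.
  by move/perm_inj ->.
set cm := (M - tn M)%N; set cn := (N - tn N)%N.
(* By the choice of [cm] and [cn] this difference is [N * tn M + tn N]; positivity of both keeps the
   truncated operations exact. *)
suff: (N * M - (N * cm.-1 + cn) <= tn (N * M))%N.
  apply: leq_trans.
  have := leq_trans (cyc_gt0 _) (rhoP 0); have := leq_trans (cyc_gt0 _) (piP 0).
  rewrite -/cm -/cn => cn0 cm0.
  have -> : tn M = (M - cm)%N by rewrite /cm in cm0 *; lia.
  have -> : tn N = (N - cn)%N by rewrite /cn in cn0 *; lia.
  have cmM : (cm <= M)%N by exact: leq_subr.
  have cnN : (cn <= N)%N by exact: leq_subr.
  move: cm cn cm0 cn0 cmM cnN => c d; nia.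
apply: (tn_ge (digits_inj JM IN)) F_inj _; first by rewrite card_prod !card_ord mulnC.
move=> b; have [c cP] := digits_shift JM IN b.
set b0 : 'I_M := b%:R in cP.
exists (fun t => (t.1 + b0, t.2 + c t.1)) => //.
set f := (X in hits X); pose u := (rotp b0 * rho)%g.
have uE j : u j = rho (j + b0) by rewrite permM permE addmodE.
pose phi j i := if j + b0 == 0 then pi (i + c j) else i + c j.
have fE k j i : (iter k f (j, i)).1 = iter k u j.
  rewrite -(iter_skew u phi k j i); congr (_.1).
  by apply: eq_iter => t; rewrite uE.
(* The shift moves [- b0] to 0, over which [pi] acts. *)
have [R Rs uR] := hits_through u (- b0).
(* By minimality of [l] the orbit avoids [- b0] before time [l], so all steps after the first only
   translate the fibre. *)
have /ex_minnP[l /andP[l0 /eqP lP] lmin] :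
    exists l, (0 < l)%N && (iter l u (- b0) == - b0).
  by exists #[u]%g; rewrite order_gt0 -permX expg_order perm1 eqxx.
have [c' retE] : exists c', forall i, iter l f (- b0, i) = (- b0, pi (i + c (- b0)) + c').
  have : forall k, (k < l)%N -> exists c', forall i,
      iter k.+1 f (- b0, i) = (iter k.+1 u (- b0), pi (i + c (- b0)) + c').
    elim=> [|k IH] kl.
      by exists 0 => i; rewrite /f /F /= addNr eqxx addr0 uE addNr.
    have [|c' IHc] := IH; first by lia.
    exists (c' + c (iter k.+1 u (- b0))) => i.
    rewrite iterS IHc; set j := iter k.+1 u _.
    have j0 : j + b0 != 0.
      apply/eqP => /eqP; rewrite addr_eq0 => j0.
      by have := lmin k.+1; rewrite -/j j0 => /(_ isT); lia.
    by rewrite /f /F /= (negPf j0) addrA -uE.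
  move/(_ l.-1); rewrite prednK // => /(_ (leqnn l))[c' retE].
  by exists c' => i; rewrite retE lP.
have [R' R's retR'] : exists2 R', (size R' <= cn)%N &
    hits (fun i => pi (i + c (- b0)) + c') R'.
  have [R' R's HR'] := hits_through (rotp (c' + c (- b0)) * pi)%g 0.
  exists [seq i + c' | i <- 0 :: R'].
    by rewrite size_map /= R's prednK ?cyc_gt0.
  apply: hits_conj => i; have [k Hk] := HR' i; exists k.
  rewrite (@eq_iter _ _ (rotp (c' + c (- b0)) * pi)%g) // => x.
  by rewrite permM permE addmodE addrA.
exists ([seq (- b0, i) | i <- R'] ++ [seq (j, i) | j <- R, i <- enum 'I_N]).
  rewrite size_cat size_map size_allpairs size_enum_ord Rs addnC leq_add //.
  rewrite mulnC leq_mul2l -!subn1 leq_sub2r ?orbT //; exact: rhoP.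
have Hret := hits_fibre retE retR'.
move=> [j i]; have [k] := uR j; rewrite inE => /orP[/eqP ek|ek].
  have [k' Hk'] := Hret (iter k f (j, i)).2; exists (k' + k)%N.
  by rewrite iterD [iter k f _]surjective_pairing fE ek mem_cat Hk'.
exists k; rewrite mem_cat; apply/orP; right.
apply/allpairsP; exists (iter k f (j, i)); split; last exact: surjective_pairing.
  by rewrite fE.
by rewrite mem_enum.
Qed.

(** * Primitive roots and affine maps of a finite field *)

Section FiniteField.

Variable F : finFieldType.
Implicit Types g r c x z : F.

Lemma finField_prim_root : exists g : F, #|F|.-1.-primitive_root g.
Proof.
have F1 : (1 < #|F|)%N := finNzRing_gt1 F.
suff /hasP[g _ gP] : has #|F|.-1.-primitive_root (enum (predC1 (0 : F))) by exists g.
apply: has_prim_root; rewrite ?enum_uniq //; first by lia.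
  apply/allP => x; rewrite mem_enum unity_rootE => /= x0.
  by apply/eqP/(mulfI x0); rewrite -exprS prednK ?(ltnW F1) // mulr1 expf_card.
by rewrite -cardE cardC1.
Qed.

Variable g : F.
Hypothesis gP : #|F|.-1.-primitive_root g.

Lemma prim_log x : x != 0 -> exists k : nat, x = g ^+ k.
Proof.
move=> x0; have F1 : (1 < #|F|)%N := finNzRing_gt1 F.
have [|k ->] := prim_rootP gP (x := x); last by exists k.
by apply: (mulfI x0); rewrite -exprS prednK ?(ltnW F1) // mulr1 expf_card.
Qed.

Lemma prim_neq0 : g != 0.
Proof.
apply/eqP => g0; have := prim_expr_order gP; have : (1 < #|F|)%N := finNzRing_gt1 F.
rewrite g0 expr0n; case: #|F| => [|[|n]] //= _ /eqP; by rewrite eq_sym oner_eq0.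
Qed.

Lemma prim_reindex R (idx : R) (op : Monoid.com_law idx) (G : F -> R) :
  \big[op/idx]_(t < #|F|.-1) G (g ^+ t) = \big[op/idx]_(v | v != 0) G v.
Proof.
rewrite -(big_mkord xpredT (fun t => G (g ^+ t))) -(big_map (fun t => g ^+ t) xpredT G).
rewrite -[RHS]big_enum; apply: perm_big; apply: uniq_perm; rewrite ?enum_uniq //.
  rewrite map_inj_in_uniq ?iota_uniq // => i j; rewrite !mem_index_iota => /andP[_ ik] /andP[_ jk] /eqP.
  by rewrite (eq_prim_root_expr gP) !modn_small // => /eqP.
move=> v; rewrite mem_enum [X in _ = X]unfold_in; apply/mapP/idP => [[t _ ->]|/prim_log[k ->]].
  exact: expf_neq0 prim_neq0.
exists (k %% #|F|.-1)%N; last by rewrite (prim_expr_mod gP).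
by rewrite mem_index_iota ltn_mod (prim_order_gt0 gP).
Qed.

Lemma iter_affine r c x z k : r * z + c = z ->
  iter k (fun x => r * x + c) x = z + r ^+ k * (x - z).
Proof.
move=> zP; elim: k => [|k /= ->]; first by rewrite /= mul1r subrKC.
by rewrite exprS mulrDr -mulrA addrAC zP.
Qed.

Lemma affine_fixpoint r c : r != 1 -> exists z, r * z + c = z.
Proof. by move=> r1; exists (c / (1 - r)); field; rewrite subr_eq0 eq_sym. Qed.

(** Around its fixed point the map is multiplication by [r], whose powers are all the nonzero
    elements. *)
Lemma hits_affine_prim r c : (2 < #|F|)%N -> (exists k, r ^+ k = g) ->
  exists2 R, (size R <= 2)%N & hits (fun x => r * x + c) R.
Proof.
move=> F2 [k rk].
have r1 : r != 1.
  apply/eqP => r1; move: rk; rewrite r1 expr1n => g1.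
  by have := prim_order_dvd gP 1; rewrite -g1 expr1n eqxx dvdn1; lia.
have [z zP] := affine_fixpoint c r1; exists [:: z; z + 1] => // x.
have [->|xz] := eqVneq x z; first by exists 0%N; rewrite inE eqxx.
have v0 : x - z != 0 by rewrite subr_eq0.
have [|l lE] := @prim_log (x - z)^-1; first by rewrite invr_eq0.
exists (k * l)%N; rewrite (iter_affine _ _ zP) exprM rk -lE mulVf //.
by rewrite !inE eqxx orbT.
Qed.

(** The powers of [r] include all nonzero squares, which leaves at most two cycles besides a fixed
    point. *)
Lemma hits_affine_sqr r c : (exists k, r ^+ k = g ^+ 2) ->
  exists2 R, (size R <= 3)%N & hits (fun x => r * x + c) R.
Proof.
move=> [k rk]; have [r1|r1] := eqVneq r 1.
  (* Here [g ^+ 2 = 1], so the field has at most three elements. *)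
  exists (enum F); last by move=> x; exists 0%N; rewrite mem_enum.
  have F3 : (#|F|.-1 <= 2)%N.
    by rewrite dvdn_leq // (prim_order_dvd gP) -rk r1 expr1n.
  by rewrite -cardE -ltnS; apply: leq_ltn_trans (leqSpred _) _; rewrite ltnS.
have [z zP] := affine_fixpoint c r1; exists [:: z; z + 1; z + g] => // x.
have [->|xz] := eqVneq x z; first by exists 0%N; rewrite inE eqxx.
have v0 : x - z != 0 by rewrite subr_eq0.
have [|l lE] := @prim_log (x - z)^-1; first by rewrite invr_eq0.
(* [g ^+ (2 * uphalf l)] carries [x - z] to 1 or [g] according to the parity of [l]. *)
exists (k * uphalf l)%N; rewrite (iter_affine _ _ zP) exprM rk -exprM.
have -> : (2 * uphalf l = odd l + l)%N by lia.
rewrite exprD -lE -mulrA mulVf // mulr1 !inE.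
by case: (odd l); rewrite ?expr0 ?expr1 eqxx !orbT.
Qed.

Lemma prim_exprz_bezout (e u v : int) (d : nat) :
  u * e + v * (#|F|.-1)%:Z = d%:Z -> exists k : nat, (g ^ e) ^+ k = g ^+ d.
Proof.
set n := #|F|.-1; move=> uvd; have n0 := prim_order_gt0 gP; rewrite -/n in n0.
have gn : g ^ n%:Z = 1 by rewrite -exprnP (prim_expr_order gP).
exists (absz (u %% n)%Z); rewrite !exprnP gez0_abs ?modz_ge0 -?lt0n_neq0 //; last by lia.
have -> : (g ^ e) ^ (u %% n)%Z = g ^ (d%:Z + n%:Z * - (v + (u %/ n)%Z * e)).
  by rewrite exprz_exp; congr (_ ^ _); rewrite -uvd {2}(divz_eq u n); ring.
by rewrite expfzDr ?prim_neq0 // -exprz_exp gn exp1rz mulr1.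
Qed.

End FiniteField.

(** The combination is [y * M] modulo [P] and [x * P] modulo [M]. *)
Lemma coprimez_comb (x y P M : int) :
  coprimez P M -> coprimez x M -> coprimez y P ->
  exists u v, u * (x * P + y * M) + v * (P * M) = 1.
Proof.
move=> PM xM yP; suff /coprimezP[[u v] /= uv] : coprimez (x * P + y * M) (P * M).
  by exists u, v.
rewrite coprimezMr; apply/andP; split.
  rewrite coprimez_sym /coprimez gcdzMDl -/(coprimez _ _) coprimezMr PM.
  by rewrite coprimez_sym yP.
rewrite coprimez_sym addrC /coprimez gcdzMDl -/(coprimez _ _) coprimezMr.
by rewrite coprimez_sym xM coprimez_sym PM.
Qed.

(** * Skew products over an affine base map *)

Section SkewProduct.

Variables (K L : finFieldType) (a : K).
Hypotheses (K2 : (2 < #|K|)%N) (aP : #|K|.-1.-primitive_root a).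

Lemma prim_neq1 : a != 1.
Proof.
apply/eqP => a1; have := prim_order_dvd aP 1.
by rewrite a1 expr1n eqxx dvdn1; lia.
Qed.

(** The base map fixes [z] and moves all other points in one cycle through [z + 1], so the fibres
    over these two points meet every orbit. *)
Lemma hits_skew (b z : K) (phi : K -> L -> L) ret R1 R2 :
  let f (t : K * L) := (a * (t.1 + b), phi t.1 t.2) in
  a * (z + b) = z -> hits (phi z) R1 ->
  (forall i, (iter #|K|.-1 f (z + 1, i)).2 = ret i) -> hits ret R2 ->
  hits f ([seq (z, i) | i <- R1] ++ [seq (z + 1, i) | i <- R2]).
Proof.
move=> f zP zR1 retE retR2.
have fE k j i : (iter k f (j, i)).1 = z + a ^+ k * (j - z).
  rewrite (iter_skew (fun j => a * (j + b)) phi) -(@iter_affine _ a (a * b)).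
    by apply: eq_iter => x; rewrite mulrDr.
  by rewrite -mulrDr.
have ret1 i : iter #|K|.-1 f (z + 1, i) = (z + 1, ret i).
  rewrite [LHS]surjective_pairing fE retE (prim_expr_order aP) mul1r.
  by rewrite [z + 1 - z]addrC addKr.
have fz i : iter 1 f (z, i) = (z, phi z i) by rewrite /= /f /= zP.
move=> [j i]; have [->|jz] := eqVneq j z.
  have [k Hk] := hits_fibre fz zR1 i.
  by exists k; rewrite mem_cat Hk.
have jz0 : j - z != 0 by rewrite subr_eq0.
have [|k kE] := prim_log aP (x := (j - z)^-1); first by rewrite invr_eq0.
have [l Hl] := hits_fibre ret1 retR2 (iter k f (j, i)).2.
exists (l + k)%N; rewrite iterD [iter k f _]surjective_pairing fE -kE mulVf //.
by rewrite mem_cat Hl orbT.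
Qed.

Lemma iter_skew_affine (u : K -> K) (r d : K -> L) k j :
  exists D, forall i, (iter k (fun t : K * L => (u t.1, r t.1 * t.2 + d t.1)) (j, i)).2
    = (\prod_(t < k) r (iter t u j)) * i + D.
Proof.
elim: k => [|k [D IH]]; first by exists 0 => i; rewrite big_ord0 mul1r addr0.
exists (r (iter k u j) * D + d (iter k u j)) => i.
rewrite iterS /= (iter_skew u (fun j i => r j * i + d j)) IH big_ord_recr /=.
by ring.
Qed.

Lemma skew_inj (r s : K -> L) : (forall x, r x != 0) ->
  injective (fun t : K * L => (a * t.1, r t.1 * t.2 + s t.1)).
Proof.
move=> r0 [j i] [j' i'] [/(mulfI (prim_neq0 aP)) <- /addIr/(mulfI (r0 j)) -> //].
Qed.

Lemma shift_fixpoint b : exists z, a * (z + b) = z.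
Proof.
by have [z zP] := affine_fixpoint (a * b) prim_neq1; exists z; rewrite mulrDr.
Qed.

(** The points [z + b + a ^+ t] run once through all of K except [z + b]. *)
Lemma prod_orbit (b z : K) (r : K -> L) : a * (z + b) = z ->
  r (z + b) * \prod_(t < #|K|.-1) r (iter t (fun j => a * (j + b)) (z + 1) + b)
  = \prod_x r x.
Proof.
move=> zP; rewrite [RHS](bigD1 (z + b)) //=; congr (_ * _).
rewrite (eq_bigr (fun t : 'I__ => r (z + b + a ^+ t))) => [|t _].
  rewrite (prim_reindex aP _ (fun v => r (z + b + v))).
  rewrite [RHS](reindex_inj (addrI (z + b))).
  by apply: eq_bigl => v; rewrite -[in RHS]subr_eq0 addrAC subrr add0r.
congr (r _); rewrite (@eq_iter _ _ (fun j => a * j + a * b)) => [|x]; last first.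
  by rewrite mulrDr.
rewrite (@iter_affine _ _ _ _ z); last by rewrite -mulrDr.
by ring.
Qed.

End SkewProduct.

(** * Exponents modulo q - 1 *)

Section Exponents.

Variables P M : int.

(* [expo] sums to M over [0, p): the first three values add up to M, the others cancel
   in pairs.  In [expo_spec] P is the 2-part and M the odd part of q - 1, so that
   gcd(x P + y M, P M) = gcd(x, M) gcd(y, P). *)
Definition expo (x : nat) : int :=
  if (x < 2)%N then P - M else if x == 2%N then -2 * P + 3 * M
  else if odd x then P + 2 * M else - P - 2 * M.

Lemma sum_expo p : odd p -> (2 < p)%N -> \sum_(0 <= x < p) expo x = M.
Proof.
move=> op p2; have -> : p = (p./2.-1.*2).+3 by lia.
elim: p./2.-1 => [|k IH]; first by rewrite !big_nat_recr //= big_nil /expo /=; ring.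
rewrite doubleS big_nat_recr // big_nat_recr // IH /expo /= odd_double /=; ring.
Qed.

End Exponents.

Lemma expo_spec (L : finFieldType) (g : L) : (2 < #|L|)%N -> odd #|L| ->
  #|L|.-1.-primitive_root g ->
  exists P M : int, forall x,
    ((exists k, (g ^ expo P M x) ^+ k = g) /\
     (exists k, (g ^ (M - expo P M x)) ^+ k = g ^+ 2)) \/
    ((exists k, (g ^ expo P M x) ^+ k = g ^+ 2) /\
     (exists k, (g ^ (M - expo P M x)) ^+ k = g)).
Proof.
move=> L2 oL gP.
have n0 : (0 < #|L|.-1)%N by lia.
have [M oM nE] := @pfactor_coprime 2 _ isT n0.
have lg : (0 < logn 2 #|L|.-1)%N.
  by rewrite logn_gt0 mem_primes n0 /= dvdn2 -subn1 oddB ?oL //; apply: ltnW (ltnW L2).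
pose P := (2 ^ logn 2 #|L|.-1)%N; pose P' := (2 ^ (logn 2 #|L|.-1).-1)%N.
have PE : P = (2 * P')%N by rewrite /P -(prednK lg) expnS.
have cPM : coprimez P M by rewrite coprimezE coprimeXl.
have cP'M : coprimez P' M by rewrite coprimezE coprimeXl.
have c3P : coprimez 3 P by rewrite coprimezE coprimeXr.
have c2M : coprimez 2 M by rewrite coprimezE.
have prim e (x y : int) : e = x * P%:Z + y * M%:Z -> coprimez x M -> coprimez y P ->
    exists k, (g ^ e) ^+ k = g.
  move=> -> xM yP; have [u [v uv]] := coprimez_comb cPM xM yP.
  by apply: (prim_exprz_bezout (u := u) (v := v) (d := 1) gP); rewrite -[RHS]uv nE PoszM; ring.
(* [e] is twice [x * P' + y * M], which is prime to [P' * M], half the order of [g]; the doubled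
   Bezout relation gives [g ^+ 2]. *)
have sqr e (x y : int) : e = x * P%:Z + 2 * y * M%:Z -> coprimez x M -> coprimez y P' ->
    exists k, (g ^ e) ^+ k = g ^+ 2.
  move=> -> xM yP; have [u [v uv]] := coprimez_comb cP'M xM yP.
  apply: (prim_exprz_bezout (u := u) (v := v) gP).
  by rewrite -[RHS]mulr1 -[X in _ = _ * X]uv nE PoszM -/P PE PoszM; ring.
have c1 (m : int) : coprimez 1 m by rewrite coprimezE coprime1n.
have cN1 (m : int) : coprimez (-1) m by rewrite coprimeNz.
exists P, M => x; rewrite /expo; case: ifP => _; last case: ifP => _; last case: ifP => _.
(* The complements to [M] in the four cases are [2 * M - P], [2 * P - 2 * M], [- P - M] and
   [P + 3 * M]. *)
- by left; split; [apply: (prim _ 1 (-1)) | apply: (sqr _ (-1) 1)] => //; ring.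
- by left; split; [apply: (prim _ (-2) 3) | apply: (sqr _ 2 (-1))]; rewrite ?coprimeNz //; ring.
- by right; split; [apply: (sqr _ 1 1) | apply: (prim _ (-1) (-1))] => //; ring.
- by right; split; [apply: (sqr _ (-1) (-1)) | apply: (prim _ 1 3)] => //; ring.
Qed.

(** * The bound pq - 5 *)

Lemma tn_primes_ge5 p q : prime p -> prime q -> (2 < p)%N -> (2 < q)%N ->
  (p * q - 5 <= tn (p * q))%N.
Proof.
move=> pp pq p2 q2.
have cK : #|'F_p| = p := card_Fp pp; have cL : #|'F_q| = q := card_Fp pq.
have [a aP] := finField_prim_root 'F_p; have [g gP] := finField_prim_root 'F_q.
have op : odd p by case: (even_prime pp) => // p2'; rewrite p2' in p2.
have oq : odd q by case: (even_prime pq) => // q2'; rewrite q2' in q2.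
have [||P [M eP]] := expo_spec _ _ gP; rewrite ?cL //.
pose r (x : 'F_p) := g ^ expo P M x.
have g0 := prim_neq0 gP.
have rtot : \prod_x r x = g ^ M.
  rewrite -[in RHS](sum_expo P M op p2) -[in RHS](Fp_cast pp) big_mkord.
  by rewrite (big_morph _ (fun x y => expfzDr x y g0) (expr0z g)).
pose F (t : 'F_p * 'F_q) := (a * t.1, r t.1 * t.2).
have F_inj : injective F.
  have r0 x : r x != 0 by exact: expfz_neq0.
  by apply: eq_inj (skew_inj (s := fun=> 0) aP r0) _ => t; rewrite /F addr0.
have JM := residues_Fp pp; have IN := residues_Fp pq.
(* With the factors swapped the low digit lies in Z_p, the base. *)
rewrite mulnC; apply: (tn_ge (digits_inj JM IN)) F_inj _.
  by rewrite card_prod cK cL mulnC.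
move=> b; have [c cP] := digits_shift JM IN b.
set b0 : 'F_p := b%:R in cP.
exists (fun t => (t.1 + b0, t.2 + c t.1)) => //.
have K2 : (2 < #|'F_p|)%N by rewrite cK.
have [z zP] := shift_fixpoint K2 aP b0.
pose phi j i := r (j + b0) * i + r (j + b0) * c j.
pose f (t : 'F_p * 'F_q) := (a * (t.1 + b0), phi t.1 t.2).
have [D retE] := iter_skew_affine (fun j => a * (j + b0)) (fun j => r (j + b0))
  (fun j => r (j + b0) * c j) #|'F_p|.-1 (z + 1).
pose x0 : 'F_p := z + b0.
(* The multipliers over the two base cycles have product [g ^ M]; cancelling the one at [x0] gives
   [r']. *)
have := prod_orbit aP r zP; set r' := (X in _ * X); rewrite rtot => r'E.
rewrite -/r' in retE.
have {}r'E : r' = g ^ (M - expo P M x0).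
  apply: (mulfI (expfz_neq0 (expo P M x0) g0)); rewrite -expfzDr //.
  by rewrite subrKC.
have [R1 [R2 [Rs HR1 HR2]]] : exists R1 R2, [/\ (size R1 + size R2 <= 5)%N,
    hits (phi z) R1 & hits (fun i => r' * i + D) R2].
  have L2 : (2 < #|'F_q|)%N by rewrite cL.
  case: (eP x0) => -[]; rewrite -r'E.
    move=> /(hits_affine_prim gP (r (z + b0) * c z) L2)[R1 s1 H1].
    move=> /(hits_affine_sqr gP D)[R2 s2 H2].
    by exists R1, R2; split=> //; rewrite (leq_add s1 s2).
  move=> /(hits_affine_sqr gP (r (z + b0) * c z))[R1 s1 H1].
  move=> /(hits_affine_prim gP D L2)[R2 s2 H2].
  by exists R1, R2; split=> //; rewrite (leq_add s1 s2).
exists ([seq (z, i) | i <- R1] ++ [seq (z + 1, i) | i <- R2]).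
  by rewrite size_cat !size_map.
move=> t; have [k Hk] := hits_skew (L := 'F_q) aP zP HR1 retE HR2 t; exists k.
rewrite (@eq_iter _ _ f); first exact: Hk.
by move=> x; congr pair; exact: mulrDr.
Qed.

(** * Character sums and the drift of the long cycle *)

Section CharacterSums.

Variables (K L : finFieldType) (a : K) (g : L).
Hypotheses (L2 : (2 < #|L|)%N) (LK : (#|L|.-1 %| #|K|.-1)%N).
Hypotheses (aP : #|K|.-1.-primitive_root a) (gP : #|L|.-1.-primitive_root g).

(** The multiplicative character sending [a] to [g], with value 0 at 0; the divisibility [LK] makes
    it independent of the chosen logarithm. *)
Definition mchar (x : K) : L :=
  if [pick k : 'I_#|K| | a ^+ k == x] is Some k then g ^+ k else 0.

Lemma mchar0 : mchar 0 = 0.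
Proof.
rewrite /mchar; case: pickP => // k; rewrite expf_eq0.
by rewrite (negPf (prim_neq0 aP)) andbF.
Qed.

Lemma mcharX t : mchar (a ^+ t) = g ^+ t.
Proof.
rewrite /mchar; case: pickP => [k|no].
  rewrite (eq_prim_root_expr aP) => kt; apply/eqP; rewrite (eq_prim_root_expr gP).
  by rewrite -(modn_dvdm k LK) -(modn_dvdm t LK) (eqP kt).
have lt : (t %% #|K|.-1 < #|K|)%N.
  by apply: leq_trans (leq_pred _); rewrite ltn_mod (prim_order_gt0 aP).
by have := no (Ordinal lt); rewrite /= (prim_expr_mod aP) eqxx.
Qed.

Lemma mcharM : {morph mchar : x y / x * y}.
Proof.
move=> x y; have [->|/(prim_log aP)[t ->]] := eqVneq x 0; first by rewrite !(mul0r, mchar0).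
have [->|/(prim_log aP)[t' ->]] := eqVneq y 0; first by rewrite !(mulr0, mchar0).
by rewrite -exprD !mcharX exprD.
Qed.

Lemma mchar1 : mchar 1 = 1.
Proof. by rewrite -(expr0 a) mcharX. Qed.

Lemma mchar_neq0 x : x != 0 -> mchar x != 0.
Proof. by case/(prim_log aP) => t ->; rewrite mcharX expf_neq0 ?(prim_neq0 gP). Qed.

Lemma mcharV x : (mchar x)^-1 = mchar x^-1.
Proof.
have [->|x0] := eqVneq x 0; first by rewrite invr0 mchar0 invr0.
by apply: (mulfI (mchar_neq0 x0)); rewrite -mcharM !mulfV ?mchar_neq0 // mchar1.
Qed.

(** Reindexing by multiplication by [a] multiplies the sum by [g], which is not 1. *)
Lemma sum_mchar : \sum_x mchar x = 0.
Proof.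
have : g * \sum_x mchar x = \sum_x mchar x.
  rewrite [RHS](reindex_inj (mulfI (prim_neq0 aP))) mulr_sumr.
  by apply: eq_bigr => x _; rewrite mcharM -(expr1 a) mcharX.
move/eqP; rewrite -subr_eq0 -{2}[\sum_x _]mul1r -mulrBl mulf_eq0 subr_eq0.
by rewrite (negPf (prim_neq1 L2 gP)) => /eqP.
Qed.

Lemma sum_mcharV : \sum_(v | v != 0) (mchar v)^-1 = 0.
Proof.
rewrite -[RHS]sum_mchar [RHS](reindex_inj invr_inj) [RHS](bigD1 0) //= invr0 mchar0 add0r.
by apply: eq_bigr => v _; rewrite mcharV.
Qed.

(** For [x != c], replacing [v] by [(x - c) / v] turns the summand into [mchar (1 + v)]; its sum
    over all [v] is 0 and the term at [v = 0] is 1. *)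
Lemma sum_mchar_shift (x c : K) :
  \sum_(v | v != 0) (mchar v)^-1 * mchar (x + v - c)
  = if x == c then (#|K|.-1)%:R else -1.
Proof.
case: eqVneq => [->|xc].
  rewrite (eq_bigr (fun=> 1)) => [|v v0]; first by rewrite sumr_const cardC1.
  by rewrite [c + v]addrC addrK mulVf ?mchar_neq0.
have d0 : x - c != 0 by rewrite subr_eq0.
have inj : injective (fun v => (x - c) / v) by move=> v w /(mulfI d0)/invr_inj.
rewrite (reindex_inj inj) /=.
rewrite (eq_bigr (fun v => mchar (1 + v))) => [|v]; last first.
  rewrite mulf_eq0 negb_or d0 invr_eq0 /= => v0.
  by rewrite mcharV -mcharM; congr mchar; field; rewrite v0.
rewrite (eq_bigl (fun v => v != 0)) => [|v]; last by rewrite mulf_eq0 negb_or d0 invr_eq0.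
apply: (addrI 1); rewrite subrr -[RHS]sum_mchar [RHS](reindex_inj (addrI 1)).
by rewrite [RHS](bigD1 0) //= addr0 mchar1.
Qed.

Lemma iter_skew_drift (u : K -> K) (d : K -> L) k j i :
  (iter k (fun t : K * L => (u t.1, g * t.2 + d t.1)) (j, i)).2
  = g ^+ k * (i + \sum_(t < k) (g ^+ t.+1)^-1 * d (iter t u j)).
Proof.
elim: k => [|k IH]; first by rewrite big_ord0 mul1r addr0.
rewrite iterS /= (iter_skew u (fun j i => g * i + d j)) IH big_ord_recr /=.
have := expf_neq0 k.+1 (prim_neq0 gP); rewrite exprS => gk0.
by field; move: gk0; rewrite mulf_eq0 negb_or andbC.
Qed.

(* Convolving [mchar] with its inverse is [#|K| * delta - 1]; one translate of [mchar]
   suffices unless #|K| = 1 in L, and then two do. *)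
Definition twist (lam : L) (x : K) := mchar x + lam * mchar (x - 1).

Lemma twist_drift (b z : K) (b' lam : L) i : a * (z + b) = z ->
  (iter #|K|.-1 (fun t : K * L =>
     (a * (t.1 + b), g * t.2 + (g * b' + twist lam (t.1 + b)))) (z + 1, i)).2
  = i + g^-1 * ((if z + b == 0 then (#|K|.-1)%:R else -1)
                + lam * (if z + b == 1 then (#|K|.-1)%:R else -1)).
Proof.
move=> zP.
rewrite (iter_skew_drift (fun j => a * (j + b)) (fun j => g * b' + twist lam (j + b))).
(* [g ^+ #|K|.-1 = 1], so the return map is a translation. *)
have [m mE] := dvdnP LK; rewrite mE mulnC exprM (prim_expr_order gP) expr1n mul1r -mulnC -mE.
congr (_ + _); rewrite (eq_bigr (fun t : 'I__ =>
  g^-1 * ((mchar (a ^+ t))^-1 * (g * b' + twist lam (z + b + a ^+ t))))).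
  rewrite -mulr_sumr; congr (_ * _).
  rewrite (prim_reindex aP _ (fun v => (mchar v)^-1 * (g * b' + twist lam (z + b + v)))).
  rewrite (eq_bigr (fun v => g * b' * (mchar v)^-1 + ((mchar v)^-1 * mchar (z + b + v - 0)
    + lam * ((mchar v)^-1 * mchar (z + b + v - 1))))) => [|v _]; last first.
    by rewrite /twist subr0; ring.
  (* The constant [g * b'] is paired with the inverse character and vanishes. *)
  rewrite big_split -mulr_sumr sum_mcharV mulr0 /= add0r big_split /= -mulr_sumr.
  by rewrite !sum_mchar_shift.
move=> t _; rewrite mcharX exprS invfM -mulrA; do 2![congr (_ * _)]; congr (_ + twist _ _).
rewrite (@eq_iter _ _ (fun j => a * j + a * b)) => [|x]; last by rewrite mulrDr.
by rewrite (@iter_affine _ _ _ _ z) -?mulrDr //; ring.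
Qed.

(** If [#|K|] is 1 in L, then [lam = 1] and the value is -1 or -2; otherwise [lam = 0] and it is
    [#|K| - 1] or -1. *)
Lemma twist_drift_neq0 (x : K) (lam : L) :
  (2 : L) != 0 -> lam = (#|K|%:R == 1 :> L)%:R ->
  (if x == 0 then (#|K|.-1)%:R else -1) + lam * (if x == 1 then (#|K|.-1)%:R else -1) != 0 :> L.
Proof.
have -> : (#|K|.-1)%:R = #|K|%:R - 1 :> L.
  by rewrite -[in RHS](ltn_predK (finNzRing_gt1 K)) -natr1 addrK.
move=> n2 ->; case: (eqVneq (#|K|%:R : L) 1) => [->|K1]; rewrite ?subrr ?mulr1 ?mul1r ?mul0r ?addr0.
  case: (eqVneq x 0) => [->|_]; first by rewrite [0 == 1]eq_sym oner_eq0 add0r oppr_eq0 oner_eq0.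
  case: ifP => _; first by rewrite addr0 oppr_eq0 oner_eq0.
  by rewrite -opprD oppr_eq0.
by case: ifP => _; rewrite ?subr_eq0 ?oppr_eq0 ?oner_eq0.
Qed.

End CharacterSums.

(** * Distinct primes with q - 1 dividing p - 1 *)

Lemma Fp_natr_neq0 q k : prime q -> (0 < k < q)%N -> (k%:R : 'F_q) != 0.
Proof.
move=> pq kq; apply/eqP => /(residues_eq (residues_Fp pq) k 0).
by rewrite mod0n modn_small; lia.
Qed.

Lemma tn_distinct_primes_ge3 p q : prime p -> prime q -> (2 < p)%N -> (2 < q)%N ->
  p != q -> (q.-1 %| p.-1)%N -> (p * q - 3 <= tn (p * q))%N.
Proof.
move=> pp pq p2 q2 npq qp.
have cK : #|'F_p| = p := card_Fp pp; have cL : #|'F_q| = q := card_Fp pq.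
have [a aP] := finField_prim_root 'F_p; have [g gP] := finField_prim_root 'F_q.
have K2 : (2 < #|'F_p|)%N by rewrite cK.
have L2 : (2 < #|'F_q|)%N by rewrite cL.
have LK : (#|'F_q|.-1 %| #|'F_p|.-1)%N by rewrite cK cL.
pose lam : 'F_q := (#|'F_p|%:R == 1 :> 'F_q)%:R.
pose s := twist a g lam.
pose F (t : 'F_p * 'F_q) := (a * t.1, g * t.2 + s t.1).
have F_inj : injective F by apply: (skew_inj (r := fun=> g) aP) => _; exact: prim_neq0.
(* These coordinates have no carries: a translation adds the same constant in every fibre, as
   [twist_drift] requires. *)
pose e (x : 'I_(p * q)) : 'F_p * 'F_q := (x%:R, x%:R).
have Jp := residues_Fp pp; have Iq := residues_Fp pq.
have e_inj : injective e.
  move=> x y exy.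
  have /(residues_eq Jp)/eqP xyp : x%:R = y%:R :> 'F_p := congr1 fst exy.
  have /(residues_eq Iq)/eqP xyq : x%:R = y%:R :> 'F_q := congr1 snd exy.
  apply/val_inj/eqP; have := chinese_remainder (m1 := p) (m2 := q) _ x y.
  rewrite xyp xyq !modn_small // => -> //.
  by rewrite prime_coprime // dvdn_prime2.
apply: (tn_ge e_inj) F_inj _; first by rewrite card_prod cK cL.
move=> b; exists (fun t => (t.1 + b%:R, t.2 + b%:R)).
  move=> x; rewrite /e /= -!natrD; congr pair.
    by apply/(residues_eq Jp); rewrite modn_dvdm // dvdn_mulr.
  by apply/(residues_eq Iq); rewrite modn_dvdm // dvdn_mull.
have [z zP] := shift_fixpoint K2 aP b%:R.
pose phi (j : 'F_p) (i : 'F_q) := g * i + (g * b%:R + s (j + b%:R)).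
pose f (t : 'F_p * 'F_q) := (a * (t.1 + b%:R), phi t.1 t.2).
have [R1 R1s HR1] : exists2 R1, (size R1 <= 2)%N & hits (phi z) R1.
  by apply: (hits_affine_prim gP) => //; exists 1%N; rewrite expr1.
pose w := (#|'F_p|.-1)%:R : 'F_q.
pose T := g^-1 * ((if z + b%:R == 0 then w else -1) + lam * (if z + b%:R == 1 then w else -1)).
have retE i : _ = i + T := twist_drift L2 LK aP gP b%:R lam i zP.
have T0 : T != 0.
  rewrite /T mulf_eq0 negb_or invr_eq0 (prim_neq0 gP) /=.
  by apply: twist_drift_neq0 => //; exact: Fp_natr_neq0.
(* A nonzero translation of Z_q is a single cycle. *)
have HR2 : hits (fun i => i + T) [:: 0].
  move=> i; exists (val (- i / T)).
  have -> : iter (val (- i / T)) (fun i => i + T) i = i + (val (- i / T))%:R * T.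
    elim: (val _) => [|k /= ->]; first by rewrite mul0r addr0.
    by rewrite -natr1; ring.
  by have [_ [-> _]] := Iq; rewrite divfK // subrr inE.
exists ([seq (z, i) | i <- R1] ++ [seq (z + 1, i) | i <- [:: 0]]).
  by rewrite size_cat !size_map (leq_add R1s (leqnn 1)).
move=> t; have [k Hk] := hits_skew (L := 'F_q) aP zP HR1 retE HR2 t; exists k.
rewrite (@eq_iter _ _ f); first exact: Hk.
by move=> x; congr pair; rewrite /phi /=; ring.
Qed.

(** * The square of an odd prime *)

Lemma prime_square_unit_generator p : prime p -> (2 < p)%N ->
  exists a : 'Z_(p * p), forall u, u \is a GRing.unit -> exists k : nat, u = a ^+ k.
Proof.
move=> pp p2; have op : odd p by case: (even_prime pp) => // p2'; rewrite p2' in p2.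
have pp1 : (1 < p * p)%N by nia.
pose G := <[Zp1 : 'Z_(p * p)]>%G.
have cG : #|G| = (p * p)%N by rewrite -orderE order_Zp1 Zp_cast.
have Gp : (p.-group G)%g by rewrite /pgroup cG pnatM !pnat_id.
have G1 : G :!=: 1%g by rewrite -cardG_gt1 cG.
(* [m] identifies the automorphisms of a cyclic group of order p^2 with the units of Z_(p^2); for
   odd p they form a cyclic group. *)
case: (cyclic_pgroup_Aut_structure Gp (cycle_cyclic _) G1) => m [[_ _ [_ munit] mX _] _].
have -> : (logn p #|G|).-1 = 1%N by rewrite cG lognM ?prime_gt0 // logn_prime // eqxx.
case=> t [_ _ _]; rewrite op => -[[/cyclicP[al alE] _] _ _].
rewrite -cG; exists (m al) => u; rewrite -munit => /imageP[x].
rewrite alE => /cycleP[k ->] ->; exists k.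
by rewrite mX // alE cycle_id.
Qed.

Lemma tn_prime_square_ge3 p : prime p -> (2 < p)%N -> (p * p - 3 <= tn (p * p))%N.
Proof.
move=> pp p2; have [a aP] := prime_square_unit_generator pp p2.
have pp1 : (1 < p * p)%N by nia.
have res := residues_Zp pp1.
have unitE (x : 'Z_(p * p)) : (x \is a GRing.unit) = ~~ (p %| x)%N.
  by rewrite -[x in LHS]natr_Zp unitZpE // coprimeMl andbb prime_coprime.
have U2 : (2%:R : 'Z_(p * p)) \is a GRing.unit.
  by rewrite unitZpE // coprimeMl andbb prime_coprime //; apply/negP => /dvdn_leq; lia.
have [k2 a2] := aP _ U2.
(* Some power of [a] is 2, so [a - 1] divides 2 - 1. *)
have a1 : 1 - a \is a GRing.unit.
  have : a ^+ k2 - 1 \is a GRing.unit by rewrite -a2 -[X in _ - X]/(1%:R) -natrB // unitr1.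
  by rewrite subrX1 unitrM => /andP[a1 _]; rewrite -opprB unitrN.
have aU : a \is a GRing.unit.
  have k0 : (0 < k2)%N.
    rewrite lt0n; apply/eqP => k0; move: a2; rewrite k0 expr0 -[RHS]/(1%:R).
    by move/(residues_eq res); rewrite !modn_small //; nia.
  by rewrite -(unitrX_pos _ k0) -a2.
apply: (tn_ge (e := fun x : 'I_(p * p) => x%:R : 'Z_(p * p)) (F := *%R a)).
- by move=> x y /(residues_eq res); rewrite !modn_small // => /val_inj.
- by rewrite card_ord Zp_cast.
- exact: mulrI.
move=> b; exists (fun x => x + b%:R).
  by move=> x; rewrite -natrD; apply/(residues_eq res); rewrite /= modn_mod.
pose z := a * b%:R / (1 - a).
have zP : a * (z + b%:R) = z.
  by apply: (mulIr a1); rewrite -mulrA mulrDl /z !divrK //; ring.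
have fE k v : iter k ( *%R a \o +%R^~ b%:R) (z + v) = z + a ^+ k * v.
  elim: k => [|k /= ->]; first by rewrite mul1r.
  by rewrite addrAC mulrDr zP exprS mulrA.
exists [:: z; z + 1; z + p%:R] => // x.
have -> : x = z + (x - z) by rewrite subrKC.
set v := x - z; have [vU|] := boolP (v \is a GRing.unit).
  have [|k kE] := aP v^-1; first by rewrite unitrV.
  by exists k; rewrite fE -kE mulVr // !inE eqxx orbT.
rewrite unitE negbK => /dvdnP[y vE].
have [v0|v0] := eqVneq v 0; first by exists 0%N; rewrite v0 addr0 inE eqxx.
(* [v] is [y * p] and nonzero modulo p^2, so p does not divide [y], and a power of [a] carries [v]
   to p. *)
have yU : (y%:R : 'Z_(p * p)) \is a GRing.unit.
  rewrite unitZpE // coprimeMl andbb prime_coprime //; apply/negP => /dvdnP[w yE].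
  by case/negP: v0; rewrite -[v]natr_Zp vE yE -mulnA natrM pchar_Zp // mulr0.
have [|k kE] := aP (y%:R)^-1; first by rewrite unitrV.
by exists k; rewrite fE -kE -[v]natr_Zp vE natrM mulKr // !inE eqxx !orbT.
Qed.

Local Close Scope ring_scope.

Theorem theorem1p4 :
  (forall n m : nat, 2 <= n -> 2 <= m -> n * tn m + tn n <= tn (n * m)) /\
  (forall p q : nat, prime p -> prime q -> 3 <= p -> 3 <= q ->
     p * q - 5 <= tn (p * q) /\
     ((q - 1) %| (p - 1) -> p * q - 3 <= tn (p * q))).
Proof.
split=> [n m|p q pp pq p2 q2]; first exact: tn_mul.
split; first exact: tn_primes_ge5.
rewrite !subn1 => qp; have [<-|npq] := eqVneq p q; first exact: tn_prime_square_ge3.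
exact: tn_distinct_primes_ge3.
Qed.
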